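(* Let $d\ge 2$, let $\mathcal{H}=\mathbb{C}^d\otimes\mathbb{C}^d$, and let $U$ be a unitary operator on $\mathcal{H}$. Then the disentangling power $\delta(U)$ is given by $$\delta(U)=\frac{1}{d-1}\bigl[S_L(|U\rangle)+S_L(|US\rangle)-S_L(|S\rangle)\bigr],$$ where $S$ is the swap operator on $\mathcal{H}$ and $|X\rangle$ denotes the vector associated with the operator $X$ on $\mathcal{H}$.
   Context: Fix an orthonormal basis $|1\rangle,\dots,|d\rangle$ of $\mathbb{C}^d$ and write $|ij\rangle=|i\rangle\otimes|j\rangle$. Normalized linear entropy: for a unit vector $|\psi\rangle\in\mathcal{K}_A\otimes\mathcal{K}_B$ with $\dim\mathcal{K}_A=\dim\mathcal{K}_B=n\ge 2$, $$S_L(|\psi\rangle):=\frac{n}{n-1}\bigl(1-\operatorname{Tr}\rho^2\bigr),\qquad \rho=\operatorname{Tr}_B|\psi\rangle\langle\psi|,$$ where $\operatorname{Tr}_B$ is the partial trace over $\mathcal{K}_B$. For vectors of $\mathcal{H}=\mathbb{C}^d\otimes\mathbb{C}^d$ one has $n=d$. Disentangling power: for a unitary $U$ on $\mathcal{H}=\mathbb{C}^d\otimes\mathbb{C}^d$, $$\delta(U):=1-\int_{U(d)}\int_{U(d)}S_L\bigl(U(V\otimes W)|\psi_+\rangle\bigr)\,dV\,dW,\qquad |\psi_+\rangle=\frac{1}{\sqrt d}\sum_{i=1}^d|ii\rangle,$$ where $dV,dW$ are the normalized Haar measures on the unitary group $U(d)$, and $S_L$ is taken with respect to the two tensor factors of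 $\mathcal{H}$. Swap: $S=\sum_{i,j=1}^d|ij\rangle\langle ji|$. Vector associated with an operator: let $\mathcal{H}_1,\mathcal{H}_2,\mathcal{H}_3,\mathcal{H}_4$ be four copies of $\mathbb{C}^d$ and identify $\mathcal{H}$ with $\mathcal{H}_1\otimes\mathcal{H}_3$. For an operator $X$ on $\mathcal{H}$ put $$|X\rangle:=(X_{13}\otimes I_{24})|\Psi_+\rangle_{13|24},\qquad |\Psi_+\rangle_{13|24}=\frac1d\sum_{i,j=1}^d|ij\rangle_{13}\otimes|ij\rangle_{24},$$ where $X_{13}$ is $X$ acting on $\mathcal{H}_1\otimes\mathcal{H}_3$ and $I_{24}$ is the identity on $\mathcal{H}_2\otimes\mathcal{H}_4$. The quantity $S_L(|X\rangle)$ is computed with respect to the bipartition $A|B=12|34$, i.e. $\mathcal{K}_A=\mathcal{H}_1\otimes\mathcal{H}_2$ and $\mathcal{K}_B=\mathcal{H}_3\otimes\mathcal{H}_4$, so that $n=d^2$. *)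

(* Defs.v *)
From HB Require Import structures.
From mathcomp Require Import all_boot all_order all_algebra.
From mathcomp Require Import all_classical all_reals all_analysis.
From mathcomp Require Import spectral complex mxtens.

Set Implicit Arguments.
Unset Strict Implicit.
Unset Printing Implicit Defensive.

Import Order.TTheory GRing.Theory Num.Theory.
Import numFieldNormedType.Exports.

Local Open Scope classical_set_scope.
Local Open Scope ring_scope.
Local Open Scope complex_scope.

(* The complex numbers over R : realType are R[i],
   seen as a numClosedFieldType, from which they get their norm topology. *)
Definition Cplx (R : realType) : numClosedFieldType := R[i].

Section LinearEntropy.
Context {R : realType}.
Local Notation C := (Cplx R).

Definition adjmx m n (A : 'M[C]_(m, n)) : 'M[C]_(n, m) :=
  map_mx Num.conj (A^T).

(* C^m (x) C^n is 'cV_(m * n), with |i>(x)|k> at position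
   mxtens_index (i, k), as for the Kronecker product *t. *)
Definition ptrace2 m n (A : 'M[C]_(m * n)) : 'M[C]_m :=
  \matrix_(i, j) \sum_(k < n) A (mxtens_index (i, k)) (mxtens_index (j, k)).

(* Tr rho^2 is real since rho is Hermitian; Re only changes its type. *)
Definition S_L n (psi : 'cV[C]_(n * n)) : R :=
  let rho := ptrace2 (psi *m adjmx psi) in
  n%:R / (n%:R - 1) * (1 - complex.Re (\tr (rho *m rho))).

End LinearEntropy.

Section Operators.
Context {R : realType}.
Variable d : nat.
Local Notation C := (Cplx R).

Definition ket (i : 'I_d) : 'cV[C]_d := delta_mx i 0.

(* The product column has 1 * 1 columns, which is convertible to 1. *)
Definition ket2 (i j : 'I_d) : 'cV[C]_(d * d) := ket i *t ket j.

Definition psi_plus : 'cV[C]_(d * d) :=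
  ((Num.sqrt (d%:R : R))^-1)%:C *: \sum_(i < d) ket2 i i.

Definition swapmx : 'M[C]_(d * d) :=
  \sum_(i < d) \sum_(j < d) ket2 i j *m adjmx (ket2 j i).

(* Tensor factors in the order H1 (x) H3 (x) H2 (x) H4. *)
Definition Psi_plus_1324 : 'cV[C]_((d * d) * (d * d)) :=
  (d%:R)^-1 *: \sum_(i < d) \sum_(j < d) (ket2 i j *t ket2 i j).

(* From the order H1 (x) H3 (x) H2 (x) H4 to H1 (x) H2 (x) H3 (x) H4. *)
Definition reorder_1234 (v : 'cV[C]_((d * d) * (d * d))) :
    'cV[C]_((d * d) * (d * d)) :=
  \col_k (let: (a, b) := mxtens_unindex k in
          let: (i1, i2) := mxtens_unindex a in
          let: (i3, i4) := mxtens_unindex b in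
          v (mxtens_index (mxtens_index (i1, i3), mxtens_index (i2, i4))) 0).

(* |X>, written in the order 12|34 so that S_L (n := d * d) cuts A|B = 12|34. *)
Definition opvec (X : 'M[C]_(d * d)) : 'cV[C]_((d * d) * (d * d)) :=
  reorder_1234 ((X *t (1%:M : 'M[C]_(d * d))) *m Psi_plus_1324).

End Operators.
Arguments psi_plus {R} d.
Arguments swapmx {R} d.

Section UnitaryGroup.
Variables (R : realType) (d : nat).
Local Notation C := (Cplx R).

Definition unitary_set : set 'M[C]_d := [set M | M \is unitarymx].

(* Subspace topology inherited from 'M[C]_d. *)
Definition unitaryGroup : Type := set_type unitary_set.
HB.instance Definition _ := Topological.on unitaryGroup.

Lemma unitary_set1 : 1%:M \in unitary_set.
Proof.
by apply: mem_set; apply/unitarymxP; rewrite trmx1 map_mx1 mulmx1.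
Qed.

Definition unitary_one : unitaryGroup := exist _ 1%:M unitary_set1.
HB.instance Definition _ := isPointed.Build unitaryGroup unitary_one.

Definition unitary_mx (V : unitaryGroup) : 'M[C]_d := set_val V.

Lemma unitary_mxP (V : unitaryGroup) : unitary_mx V \is unitarymx.
Proof. exact: set_mem (valP V). Qed.

Lemma unitary_setM (V W : unitaryGroup) :
  unitary_mx V *m unitary_mx W \in unitary_set.
Proof. by apply: mem_set; apply: mul_unitarymx; exact: unitary_mxP. Qed.

Definition unitary_mul (V W : unitaryGroup) : unitaryGroup :=
  exist _ (unitary_mx V *m unitary_mx W) (unitary_setM V W).

(* U(d) with its Borel sigma-algebra. *)
Definition borelU := g_sigma_algebraType (@open unitaryGroup).

(* On the compact group U(d) a left-invariant Borel probability exists, is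
   unique, and is also right-invariant. *)
Definition is_haar (mu : probability borelU R) : Prop :=
  forall (g : unitaryGroup) (A : set borelU), measurable A ->
    mu [set unitary_mul g h | h in A] = mu A.

End UnitaryGroup.

Definition disentangling_power (R : realType) (d : nat)
    (mu : probability (borelU R d) R) (U : 'M[Cplx R]_(d * d)) : R :=
  1 - \int[mu]_(V in setT) \int[mu]_(W in setT)
        S_L (U *m (unitary_mx V *t unitary_mx W) *m psi_plus d).

(* Main.v *)
(* For fixed V, (V (x) W)|psi_+> has the entries of W V^T up to a factor.  By left
   invariance alone, the average over W of the fourth moments of W V^T is
   invariant under conjugation by g (x) g for all unitary g, hence is a combination
   of the identity and the flip; testing against phases, permutations and one
   Hadamard rotation is enough to see this.  Two traces give the coefficients,
   so the inner integral does not depend on V.  The mean of Tr rho^2 is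
     (d^3 + d^3 - (d^4 u + d^4 v) / d) / (d^2 (d^2 - 1)),
   where u and v are the purities of |U> and |US> and the two terms d^3 only
   use that U is unitary. *)
Require Import Defs.
From HB Require Import structures.
From mathcomp Require Import all_boot all_order all_algebra fingroup perm.
From mathcomp Require Import all_classical all_reals all_analysis.
From mathcomp Require Import measurable_realfun spectral complex mxtens ring.

Set Implicit Arguments.
Unset Strict Implicit.
Unset Printing Implicit Defensive.

Import Order.TTheory GRing.Theory Num.Theory.
Import numFieldNormedType.Exports.

Local Open Scope classical_set_scope.
Local Open Scope ring_scope.

(** The moment formula pairs the two input index pairs [K = (i, k)] and [K' = (i', k')] of [U] with
    the two of its conjugates in four ways. Pairings of whole pairs turn the sums over [K] and [K']
    into inner products of rows of [U]. Pairings that take one component from each pair are what the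
    cut 12|34 produces in the purity of an operator vector; exchanging the inputs [i] and [k]
    carries one such pairing to the other, and this is how [US] enters. The term with [S] only
    absorbs a constant: its entropy is 1. The moments are complex while the integrals are real, so a
    complex integral is assembled from real and imaginary parts, on a class of integrands stable
    under all the algebra required. *)

Lemma sum_delta (S : pzSemiRingType) (I : finType) (F : I -> S) (i : I) :
  \sum_j (i == j)%:R * F j = F i.
Proof.
rewrite (bigD1 i) //= eqxx mul1r big1 ?addr0 // => j ji.
by rewrite eq_sym (negbTE ji) mul0r.
Qed.

(** * Operators commuting with [g (x) g] for every unitary [g] *)

Section Commutant.
Variables (C : numClosedFieldType) (d : nat).
Implicit Types (g : 'M[C]_d) (a b c e f : 'I_d).

(** [M a c e f] is the entry of an operator on two copies of the space, with row [(a, c)] and column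
    [(e, f)]; the condition is invariance under conjugation by [g (x) g]. The sums are nested so
    that they can be evaluated from the inside out. *)
Definition twirl_invariant (M : 'I_d -> 'I_d -> 'I_d -> 'I_d -> C) : Prop :=
  forall g, g \is unitarymx -> forall a c e f,
    M a c e f = \sum_a' g a a' * \sum_c' g c c' *
      \sum_e' (g e e')^* * \sum_f' (g f f')^* * M a' c' e' f'.

(** One family gives both tests: [s = 1] yields diagonal phases, [w = 1] permutation matrices. *)
Definition phase_perm_mx (w : 'I_d -> C) (s : 'S_d) : 'M[C]_d :=
  \matrix_(i, j) (w i * (s i == j)%:R).

Lemma phase_perm_row w s i (F : 'I_d -> C) :
  \sum_j phase_perm_mx w s i j * F j = w i * F (s i).
Proof.
by rewrite -(sum_delta F) mulr_sumr; apply: eq_bigr => j _; rewrite mxE mulrA.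
Qed.

Lemma phase_perm_row_conj w s i (F : 'I_d -> C) :
  \sum_j (phase_perm_mx w s i j)^* * F j = (w i)^* * F (s i).
Proof.
rewrite -(sum_delta F) mulr_sumr; apply: eq_bigr => j _.
by rewrite mxE rmorphM /= conjC_nat mulrA.
Qed.

Lemma phase_perm_unitary w s : (forall i, `|w i| = 1) ->
  phase_perm_mx w s \is unitarymx.
Proof.
move=> w1; apply/unitarymxP/matrixP => i j; rewrite !mxE.
rewrite phase_perm_row !mxE rmorphM /= conjC_nat mulrA (inj_eq perm_inj).
rewrite eq_sym; case: eqP => [->|_] /=; last by rewrite mulr0.
by rewrite mulr1 -normCK w1 expr1n.
Qed.

(** The 2 by 2 Hadamard matrix on the span of the basis vectors [a] and [b], the identity
    elsewhere. *)
Definition hadamard_mx a b : 'M[C]_d :=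
  \matrix_(i, j) if i == a then (sqrtC 2)^-1 * ((a == j)%:R + (b == j)%:R)
    else if i == b then (sqrtC 2)^-1 * ((a == j)%:R - (b == j)%:R)
    else (i == j)%:R.

Lemma hadamard_row a b i (F : 'I_d -> C) :
  \sum_j hadamard_mx a b i j * F j =
    if i == a then (sqrtC 2)^-1 * (F a + F b)
    else if i == b then (sqrtC 2)^-1 * (F a - F b) else F i.
Proof.
under eq_bigr do rewrite mxE.
case: ifP => _; last case: ifP => _; last exact: sum_delta.
  rewrite -(sum_delta F a) -(sum_delta F b) -big_split mulr_sumr.
  by apply: eq_bigr => j _; rewrite -mulrA mulrDl.
rewrite -(sum_delta F a) -(sum_delta F b) -sumrB mulr_sumr.
by apply: eq_bigr => j _; rewrite -mulrA mulrBl.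
Qed.

Lemma invr_sqrt2_conj : ((sqrtC 2)^-1)^* = (sqrtC 2)^-1 :> C.
Proof. by apply/CrealP; rewrite realV ger0_real // sqrtC_ge0. Qed.

Lemma hadamard_conj a b i j : (hadamard_mx a b i j)^* = hadamard_mx a b i j.
Proof.
rewrite mxE; case: ifP => _; last case: ifP => _; last exact: conjC_nat.
  by rewrite rmorphM rmorphD /= !conjC_nat invr_sqrt2_conj.
by rewrite rmorphM rmorphB /= !conjC_nat invr_sqrt2_conj.
Qed.

Lemma invr_sqrt2_sqr : (sqrtC 2)^-1 * (sqrtC 2)^-1 *+ 2 = 1 :> C.
Proof. by rewrite -expr2 exprVn sqrtCK -mulr_natr mulVf // pnatr_eq0. Qed.

Lemma hadamard_unitary a b : a != b -> hadamard_mx a b \is unitarymx.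
Proof.
move=> ab; have ba : b != a by rewrite eq_sym.
apply/unitarymxP/matrixP => i j; rewrite [RHS]mxE.
transitivity (\sum_k hadamard_mx a b i k * hadamard_mx a b j k).
  rewrite mxE; apply: eq_bigr => k _.
  by congr (_ * _); rewrite [LHS]mxE [X in X^*]mxE hadamard_conj.
rewrite hadamard_row !mxE !eqxx (negbTE ab) (negbTE ba).
move: invr_sqrt2_sqr; set h := (sqrtC 2)^-1 => hh.
case: (i =P a) => [->|/eqP ia].
  rewrite (eq_sym a j); case: (j =P a) => [_|/eqP ja].
    by transitivity (h * h *+ 2); [rewrite /=; ring|exact: hh].
  by case: (j =P b) => [_|/eqP jb] /=; ring.
case: (i =P b) => [->|/eqP ib].
  rewrite (eq_sym b j); case: (j =P a) => [->|/eqP ja].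
    by rewrite (negbTE ab) /=; ring.
  case: (j =P b) => [_|/eqP jb] /=; last by ring.
  by transitivity (h * h *+ 2); [ring|exact: hh].
rewrite (eq_sym a i) (eq_sym b i) (negbTE ia) (negbTE ib).
case: (j =P a) => [->|/eqP ja]; rewrite ?(negbTE ia); first by rewrite /=; ring.
case: (j =P b) => [->|/eqP jb]; rewrite ?(negbTE ib); first by rewrite /=; ring.
by rewrite eq_sym.
Qed.

Lemma phases_neq1 (z : C) : [|| z == 'i, z == - 'i | z == -1] -> z != 1.
Proof.
have n1 : (-1 : C) != 1 by rewrite -subr_eq0 -opprD oppr_eq0 -mulr2n pnatr_eq0.
case/or3P => /eqP -> //; apply/eqP => /(congr1 (fun x => x ^+ 2));
  by rewrite ?sqrrN sqrCi expr1n => /eqP; rewrite (negbTE n1).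
Qed.

Lemma perm_two_points a b a' b' : a != b -> a' != b' ->
  exists s : 'S_d, s a = a' /\ s b = b'.
Proof.
(* The first transposition sends [a] to [a']; the second moves the image of [b] to [b'] and fixes
   [a']. *)
move=> ab ab'; exists (tperm a a' * tperm (tperm a a' b) b')%g.
split; rewrite permM; last exact: tpermL.
rewrite tpermL; apply: tpermD; last by rewrite eq_sym.
apply: contra ab => /eqP E.
by apply/eqP/(@perm_inj _ (tperm a a')); rewrite tpermL E.
Qed.

Section Invariant.
Variable M : 'I_d -> 'I_d -> 'I_d -> 'I_d -> C.
Hypothesis M_inv : twirl_invariant M.

Lemma twirl_phase_perm (w : 'I_d -> C) (s : 'S_d) a c e f :
  (forall i, `|w i| = 1) ->
  M a c e f = w a * w c * (w e)^* * (w f)^* * M (s a) (s c) (s e) (s f).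
Proof.
move=> w1; rewrite (M_inv (phase_perm_unitary s w1)).
under eq_bigr => a' _ do under eq_bigr => c' _ do under eq_bigr => e' _
  do rewrite phase_perm_row_conj.
under eq_bigr => a' _ do under eq_bigr => c' _ do rewrite phase_perm_row_conj.
under eq_bigr => a' _ do rewrite phase_perm_row.
by rewrite phase_perm_row !mulrA.
Qed.

Lemma twirl_unbalanced k a c e f :
  ((a == k) + (c == k) != (e == k) + (f == k))%N -> M a c e f = 0.
Proof.
(* The phases at k multiply M a c e f by 'i ^ n for some 0 < |n| <= 2. *)
pose w i : C := if i == k then 'i else 1.
have w1 i : `|w i| = 1 by rewrite /w; case: ifP; rewrite ?normCi ?normr1.
have := twirl_phase_perm 1 a c e f w1; rewrite !perm1.
set z := w a * _ * _ * _ => Mz unb.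
have : z != 1.
  apply: phases_neq1; move: unb; rewrite /z /w.
  have ii : 'i * 'i = -1 :> C by rewrite -expr2 sqrCi.
  by case: (a == k); case: (c == k); case: (e == k); case: (f == k) => //= _;
    rewrite ?conjCi ?rmorph1 ?(mul1r, mulr1, mulrN, mulNr, opprK, ii) ?eqxx ?orbT.
move=> z1; apply/eqP; have /eqP := Mz.
rewrite -subr_eq0 -{1}[M a c e f]mul1r -mulrBl mulf_eq0 subr_eq0.
by rewrite eq_sym (negbTE z1).
Qed.

Lemma twirl_perm a b a' b' : a != b -> a' != b' ->
  M a b a b = M a' b' a' b' /\ M a b b a = M a' b' b' a'.
Proof.
move=> ab ab'; have [s [sa sb]] := perm_two_points ab ab'.
have w1 (i : 'I_d) : `|1 : C| = 1 by rewrite normr1.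
by split; rewrite (twirl_phase_perm s _ _ _ _ w1) rmorph1 !mul1r sa sb.
Qed.

(** Conjugation by the Hadamard matrix expands [M a a a a] into sixteen entries with indices in
    [{a, b}], each weighted by 1/4. Ten are unbalanced and vanish; by permutation invariance the
    other six are twice each of [M a a a a], [M a b a b] and [M a b b a]. *)
Lemma twirl_diag a b : a != b -> M a a a a = M a b a b + M a b b a.
Proof.
move=> ab; have ba : b != a by rewrite eq_sym.
move: (M_inv (hadamard_unitary ab) a a a a).
under eq_bigr => a' _ do under eq_bigr => c' _ do under eq_bigr => e' _
  do under eq_bigr => f' _ do rewrite hadamard_conj.
under eq_bigr => a' _ do under eq_bigr => c' _ do under eq_bigr => e' _
  do rewrite hadamard_row hadamard_conj.
under eq_bigr => a' _ do under eq_bigr => c' _ do rewrite hadamard_row.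
under eq_bigr => a' _ do rewrite hadamard_row.
rewrite hadamard_row !eqxx.
have Za c e f : ((a == a) + (c == a) != (e == a) + (f == a))%N -> M a c e f = 0.
  exact: twirl_unbalanced.
have Zb c e f : ((b == a) + (c == a) != (e == a) + (f == a))%N -> M b c e f = 0.
  exact: twirl_unbalanced.
rewrite (Za a a b) ?(Za a b a) ?(Za a b b) ?(Za b a a) ?(Za b b b) ?(Zb a a a)
  ?(Zb a b b) ?(Zb b a a) ?(Zb b a b) ?(Zb b b a) ?eqxx ?(negbTE ba) //.
have [-> ->] := twirl_perm ba ab.
have -> : M b b b b = M a a a a.
  have w1 (i : 'I_d) : `|1 : C| = 1 by rewrite normr1.
  by rewrite (twirl_phase_perm (tperm a b) _ _ _ _ w1) rmorph1 !mul1r tpermR.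
have hh := invr_sqrt2_sqr.
set h := (sqrtC 2)^-1 in hh *; set z := M a a a a; set x := M a b a b.
set y := M a b b a => E.
have E4 : z *+ 4 = (z + x + y) *+ 2.
  rewrite [in LHS]E -[RHS]mul1r -[X in _ = X * _]mul1r -[X in _ = X * _ * _]hh.
  by rewrite -[X in _ = _ * X * _]hh; ring.
have n2 : (2 : C) != 0 by rewrite pnatr_eq0.
apply: (mulfI n2); rewrite mulr_natl.
have -> : z *+ 2 = z *+ 4 - z *+ 2 by ring.
by rewrite E4; ring.
Qed.

Lemma twirl_invariantE : (2 <= d)%N ->
  exists x y, forall a c e f,
    M a c e f = (a == e)%:R * (c == f)%:R * x + (a == f)%:R * (c == e)%:R * y.
Proof.
move=> d2.
pose a0 := Ordinal (ltnW d2); pose b0 := Ordinal d2.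
have ab0 : a0 != b0 by [].
(* The coefficients of the identity and of the flip are read off at one pair of distinct indices.
   Entries with all indices equal must then be [x + y], which is [twirl_diag]. *)
exists (M a0 b0 a0 b0), (M a0 b0 b0 a0) => a c e f.
have [<-{c}|ac] := eqVneq a c.
  have [<-{e}|ae] := eqVneq a e; last first.
    rewrite (@twirl_unbalanced a); first by rewrite !(mulr0, mul0r) addr0.
    by rewrite eqxx [e == a]eq_sym (negbTE ae); case: (f == a).
  have [<-{f}|af] := eqVneq a f; last first.
    rewrite (@twirl_unbalanced a); first by rewrite !(mulr0, mul0r) addr0.
    by rewrite eqxx [f == a]eq_sym (negbTE af).
  rewrite /= !mul1r.
  have [b ab] : exists b, a != b.
    by have [->|] := eqVneq a a0; [exists b0|exists a0].
  by rewrite (twirl_diag ab); have [-> ->] := twirl_perm ab ab0.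
have [xE yE] := twirl_perm ac ab0.
have [<-{e}|ae] := eqVneq a e.
  rewrite [c == a]eq_sym (negbTE ac) mulr0 mul0r addr0 mul1r.
  have [<-{f}|cf] := eqVneq c f; first by rewrite mul1r.
  rewrite (@twirl_unbalanced c) ?mul0r // eqxx (negbTE ac) [f == c]eq_sym.
  by rewrite (negbTE cf).
rewrite !mul0r add0r.
have [<-{f}|af] := eqVneq a f; last first.
  rewrite (@twirl_unbalanced a) ?mul0r // eqxx [e == a]eq_sym (negbTE ae).
  by rewrite [f == a]eq_sym (negbTE af).
have [<-{e ae}|ce] := eqVneq c e; first by rewrite !mul1r.
rewrite (@twirl_unbalanced c) ?mulr0 ?mul0r // eqxx (negbTE ac) [e == c]eq_sym.
by rewrite (negbTE ce).
Qed.

End Invariant.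

End Commutant.

(** * Continuity of matrix products and of real and imaginary parts *)

Lemma mx_continuous (X : topologicalType) (K : numFieldType) m n
    (f : X -> 'M[K]_(m, n)) :
  (forall i j, continuous (fun x => f x i j)) -> continuous f.
Proof.
move=> cf x A [P Px PA].
have : \forall y \near x, forall i j, P i j (f y i j).
  apply: filter_forall => i; apply: filter_forall => j.
  exact: (cf i j x _ (Px i j)).
by apply: filterS => y Py; exact: PA.
Qed.

Lemma mulmx_continuous (K : numFieldType) m n p (A : 'M[K]_(m, n)) :
  continuous (mulmx A : 'M[K]_(n, p) -> 'M[K]_(m, p)).
Proof.
apply: mx_continuous => i j.
under eq_fun do rewrite mxE.
apply: (@continuous_big K _ +%R 0 xpredT) => [|k _ x]; first exact: add_continuous.
apply: (@cvgM _ _ _ (nbhs_filter x) (fun=> A i k) (fun B : 'M[K]_(n, p) => B k j)).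
  exact: cvg_cst.
exact: coord_continuous.
Qed.

Section RealParts.
Variable R : realType.

Lemma ler_normRe (z : Cplx R) : (`|complex.Re z|)%:C%C <= `|z|.
Proof. exact: (@normc_ge_Re R z). Qed.

Lemma ler_normIm (z : Cplx R) : (`|complex.Im z|)%:C%C <= `|z|.
Proof. by rewrite (@normc_def R z) lecR -sqrtr_sqr ler_wsqrtr // lerDr sqr_ge0. Qed.

(** An additive map dominated by the modulus is 1-Lipschitz; this treats [Re] and [Im] at once. *)
Lemma continuous_real_part (p : {additive (Cplx R) -> R}) :
  (forall z : Cplx R, (`|p z|)%:C%C <= `|z|) ->
  continuous (p : Cplx R -> R).
Proof.
move=> ph z A /nbhs_ballP [e /= e0 eA]; apply/nbhs_ballP.
(* Balls of [Cplx R] have their radii in [Cplx R] itself, hence the embedding of the real radius. *)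
exists (e%:C%C : Cplx R); first by rewrite /= ltcR.
move=> w zw; apply: eA; move: zw.
rewrite -!ball_normE /= => zw; rewrite -raddfB -ltcR.
exact: le_lt_trans (ph _) zw.
Qed.

Lemma Re_continuous : continuous (@complex.Re R : Cplx R -> R).
Proof. exact: (@continuous_real_part (@complex.Re R)) ler_normRe. Qed.

Lemma Im_continuous : continuous (@complex.Im R : Cplx R -> R).
Proof. exact: (@continuous_real_part (@complex.Im R)) ler_normIm. Qed.

End RealParts.

(** * Complex integration over the unitary group *)

Section Haar.
Variables (R : realType) (d : nat).
Local Notation C := (Cplx R).
Local Notation G := (borelU R d).

Lemma continuous_measurable_borelU (f : unitaryGroup R d -> R) :
  continuous f -> measurable_fun (setT : set G) (f : G -> R).
Proof.
move=> cf mD; apply: (measurability _ (RGenOInfty.measurableE R)) => //.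
move=> _ [_ [x ->] <-]; apply: measurableI => //.
apply: sub_sigma_algebra; move/continuousP: cf; apply.
exact: rray_open.
Qed.

Lemma continuous_measurable_endo (f : unitaryGroup R d -> unitaryGroup R d) :
  continuous f -> measurable_fun (setT : set G) (f : G -> G).
Proof.
move=> /continuousP cf; have mD := @measurableT _ G.
apply: (@measurability _ _ G G setT f (@open (unitaryGroup R d)) erefl).
move=> _ [A oA <-]; apply: measurableI => //.
by apply: sub_sigma_algebra; apply: cf.
Qed.

Lemma unitary_mx_inj : injective (@unitary_mx R d).
Proof. exact: val_inj. Qed.

Lemma unitary_mxM (V W : unitaryGroup R d) :
  unitary_mx (unitary_mul V W) = unitary_mx V *m unitary_mx W.
Proof. by rewrite {1}/unitary_mx set_valE. Qed.

Lemma unitary_mx_surj (A : 'M[C]_d) : A \is unitarymx ->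
  exists g : unitaryGroup R d, unitary_mx g = A.
Proof.
move=> Au; have Ain : A \in @unitary_set R d by exact: mem_set.
by exists (exist (fun B => B \in @unitary_set R d) A Ain : unitaryGroup R d);
  rewrite /unitary_mx set_valE.
Qed.

Lemma unitary_mx_continuous : continuous (@unitary_mx R d).
Proof. exact: initial_continuous. Qed.

Lemma unitary_mul_continuous (g : unitaryGroup R d) :
  continuous (unitary_mul g).
Proof.
apply: (@continuous_comp_initial (set_type (@unitary_set R d)) _ _ set_val).
have -> : set_val \o unitary_mul g = mulmx (unitary_mx g) \o @unitary_mx R d.
  by apply/funext => x; rewrite /= set_valE.
move=> x; apply: continuous_comp; first exact: unitary_mx_continuous.
exact: mulmx_continuous.
Qed.

(** The working class of integrands: it contains the matrix entries, is closed under sums, products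
    and conjugation, and consists of integrable functions because [mu] is finite. Measurability is
    asked of the two real components, which are what is integrated. *)
Definition bounded_measurable (f : G -> C) : Prop :=
  [/\ measurable_fun setT (fun W => complex.Re (f W)),
      measurable_fun setT (fun W => complex.Im (f W)) &
      exists M : R, forall W, `|f W| <= M%:C%C].

Lemma bounded_measurable_cst (c : C) : bounded_measurable (fun=> c).
Proof.
split; [exact: measurable_cst|exact: measurable_cst|].
by exists (complex.Re `|c|) => W; rewrite RRe_real ?normr_real.
Qed.

Lemma bounded_measurableD f g : bounded_measurable f -> bounded_measurable g ->
  bounded_measurable (fun W => f W + g W).
Proof.
move=> [rf jf [M fM]] [rg jg [N gN]]; split.
- under eq_fun do rewrite raddfD /=.
  exact: measurable_funD.
- under eq_fun do rewrite raddfD /=.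
  exact: measurable_funD.
- exists (M + N) => W; rewrite rmorphD; apply: le_trans (ler_normD _ _) _.
  exact: lerD.
Qed.

Lemma complex_ReM (x y : C) : complex.Re (x * y) =
  complex.Re x * complex.Re y - complex.Im x * complex.Im y.
Proof. by case: x; case: y. Qed.

Lemma complex_ImM (x y : C) : complex.Im (x * y) =
  complex.Re x * complex.Im y + complex.Im x * complex.Re y.
Proof. by case: x; case: y. Qed.

Lemma bounded_measurableM f g : bounded_measurable f -> bounded_measurable g ->
  bounded_measurable (fun W => f W * g W).
Proof.
move=> [rf jf [M fM]] [rg jg [N gN]]; split.
- under eq_fun do rewrite complex_ReM.
  by apply: measurable_funB; apply: measurable_funM.
- under eq_fun do rewrite complex_ImM.
  by apply: measurable_funD; apply: measurable_funM.
- exists (M * N) => W; rewrite rmorphM normrM; exact: ler_pM.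
Qed.

Lemma bounded_measurable_conj f : bounded_measurable f ->
  bounded_measurable (fun W => (f W)^*).
Proof.
move=> [rf jf [M fM]]; split.
- by rewrite (_ : (fun _ => _) = fun W => complex.Re (f W)) //;
    apply/funext => W; case: (f W).
- rewrite (_ : (fun _ => _) = fun W => - complex.Im (f W)).
    exact: measurable_funN.
  by apply/funext => W; case: (f W).
- by exists M => W; rewrite norm_conjC.
Qed.

Lemma bounded_measurable_moment f1 f2 f3 f4 :
  bounded_measurable f1 -> bounded_measurable f2 ->
  bounded_measurable f3 -> bounded_measurable f4 ->
  bounded_measurable (fun W => f1 W * f2 W * (f3 W)^* * (f4 W)^*).
Proof.
move=> b1 b2 /bounded_measurable_conj b3 /bounded_measurable_conj b4.
exact: bounded_measurableM (bounded_measurableM (bounded_measurableM b1 b2) b3) b4.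
Qed.

Lemma bounded_measurable_sum (I : Type) (r : seq I) (f : I -> G -> C) :
  (forall i, bounded_measurable (f i)) ->
  bounded_measurable (fun W => \sum_(i <- r) f i W).
Proof.
move=> bf; elim: r => [|i r IH].
  by under eq_fun do rewrite big_nil; exact: bounded_measurable_cst.
by under eq_fun do rewrite big_cons; exact: bounded_measurableD.
Qed.

Lemma unitary_entry_le1 n (A : 'M[C]_n) i j : A \is unitarymx -> `|A i j| <= 1.
Proof.
move=> /unitarymxP /matrixP /(_ i i); rewrite !mxE eqxx mulr1n => AA.
rewrite -(@ler_pXn2r _ 2) ?nnegrE // expr1n -AA (bigD1 j) //= !mxE -normCK.
rewrite lerDl; apply: sumr_ge0 => k _; rewrite !mxE -normCK.
exact: exprn_ge0.
Qed.

Lemma bounded_measurable_entry i j :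
  bounded_measurable (fun W => unitary_mx W i j).
Proof.
have ce : continuous (fun W : unitaryGroup R d => unitary_mx W i j).
  move=> W.
  apply: (@continuous_comp _ _ _ (@unitary_mx R d) (fun A : 'M[C]_d => A i j)).
    exact: unitary_mx_continuous.
  exact: coord_continuous.
split.
- apply: (@continuous_measurable_borelU (fun W => complex.Re (unitary_mx W i j))).
  move=> W; apply: continuous_comp; [exact: ce|exact: Re_continuous].
- apply: (@continuous_measurable_borelU (fun W => complex.Im (unitary_mx W i j))).
  move=> W; apply: continuous_comp; [exact: ce|exact: Im_continuous].
- by exists 1 => W; apply: unitary_entry_le1; exact: unitary_mxP.
Qed.

Variable mu : probability G R.

Definition Cintegral (f : G -> C) : C :=
  ((\int[mu]_(W in setT) complex.Re (f W)) +i*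
   (\int[mu]_(W in setT) complex.Im (f W)))%C.

Lemma Re_integrable f : bounded_measurable f ->
  mu.-integrable setT (EFin \o (fun W => complex.Re (f W))).
Proof.
move=> [rf _ [M fM]]; apply: measurable_bounded_integrable => //.
  exact: le_lt_trans (probability_le1 mu measurableT) (ltry 1).
- exists M; split; first exact: num_real.
  move=> x Mx W _; apply: le_trans (ltW Mx).
  by rewrite -lecR; apply: le_trans (fM W); exact: ler_normRe.
Qed.

Lemma Im_integrable f : bounded_measurable f ->
  mu.-integrable setT (EFin \o (fun W => complex.Im (f W))).
Proof.
move=> [_ rf [M fM]]; apply: measurable_bounded_integrable => //.
  exact: le_lt_trans (probability_le1 mu measurableT) (ltry 1).
- exists M; split; first exact: num_real.
  move=> x Mx W _; apply: le_trans (ltW Mx).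
  by rewrite -lecR; apply: le_trans (fM W); exact: ler_normIm.
Qed.

Lemma Rintegral_probability_cst (r : R) : \int[mu]_(W in setT) r = r.
Proof.
rewrite Rintegral_cst //; transitivity (r * fine (1%E : \bar R)).
  by congr (_ * fine _); exact: probability_setT.
by rewrite mulr1.
Qed.

Lemma Cintegral_cst c : Cintegral (fun=> c) = c.
Proof. by rewrite /Cintegral !Rintegral_probability_cst; case: c. Qed.

Lemma CintegralD f g : bounded_measurable f -> bounded_measurable g ->
  Cintegral (fun W => f W + g W) = Cintegral f + Cintegral g.
Proof.
move=> bf bg; rewrite /Cintegral.
under eq_Rintegral do rewrite raddfD.
rewrite RintegralD ?Re_integrable //.
under [X in (_ +i* X)%C]eq_Rintegral do rewrite raddfD.
by rewrite RintegralD ?Im_integrable.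
Qed.

Lemma CintegralZ c f : bounded_measurable f ->
  Cintegral (fun W => c * f W) = c * Cintegral f.
Proof.
move=> bf; have rf := Re_integrable bf; have jf := Im_integrable bf.
have Zi (a : R) (h : G -> R) : mu.-integrable setT (EFin \o h) ->
    mu.-integrable setT (EFin \o (fun W => a * h W)).
  by move=> ih; exact: (integrableZl _ a ih).
rewrite /Cintegral.
under eq_Rintegral do rewrite complex_ReM.
rewrite RintegralB ?Zi // !RintegralZl //.
under [X in (_ +i* X)%C]eq_Rintegral do rewrite complex_ImM.
rewrite RintegralD ?Zi // !RintegralZl //.
by case: c.
Qed.

Lemma Cintegral_sum (I : Type) (r : seq I) (f : I -> G -> C) :
  (forall i, bounded_measurable (f i)) ->
  Cintegral (fun W => \sum_(i <- r) f i W) = \sum_(i <- r) Cintegral (f i).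
Proof.
move=> bf; elim: r => [|i r IH].
  by rewrite big_nil; under eq_fun do rewrite big_nil; exact: Cintegral_cst.
rewrite big_cons; under eq_fun do rewrite big_cons.
by rewrite CintegralD ?IH //; exact: bounded_measurable_sum.
Qed.

Hypothesis mu_haar : is_haar mu.

Lemma unitary_mulKV (g : unitaryGroup R d) :
  exists h, cancel (unitary_mul h) (unitary_mul g).
Proof.
have gV : unitary_mx g *m adjmx (unitary_mx g) = 1%:M.
  exact/unitarymxP/unitary_mxP.
have [|h hE] := @unitary_mx_surj (adjmx (unitary_mx g)).
  by rewrite trmxC_unitary unitary_mxP.
exists h => W; apply: unitary_mx_inj.
by rewrite !unitary_mxM hE mulmxA gV mul1mx.
Qed.

(** [is_haar] speaks of images of sets, whereas a change of variables involves preimages. Left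
    translation by [g] is onto, so the image of the preimage of [A] is [A] again and the pushforward
    of [mu] agrees with [mu]. *)
Lemma Cintegral_mul (g : unitaryGroup R d) f : bounded_measurable f ->
  Cintegral (fun W => f (unitary_mul g W)) = Cintegral f.
Proof.
move=> bf.
have mg := continuous_measurable_endo (@unitary_mul_continuous g).
have pf A : measurable A -> pushforward mu (unitary_mul g : G -> G) A = mu A.
  move=> mA; rewrite /pushforward.
  rewrite -(@mu_haar g (unitary_mul g @^-1` A)); last first.
    by rewrite -[X in measurable X]setTI; exact: mg.
  congr (mu _); apply/seteqP; split=> W /=.
    by move=> [V AV <-].
  move=> AW; have [h hK] := unitary_mulKV g.
  by exists (unitary_mul h W); rewrite /= hK.
have inv (k : G -> R) : measurable_fun setT k ->
    mu.-integrable setT (EFin \o (fun W => k (unitary_mul g W))) ->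
    \int[mu]_(W in setT) k (unitary_mul g W) = \int[mu]_(W in setT) k W.
  move=> /measurable_EFinP mk ik; rewrite /Rintegral; congr fine.
  rewrite -[LHS](@integral_pushforward _ _ _ _ _ _ mg mu setT _ mk ik measurableT).
  by apply: eq_measure_integral => A mA _; exact: pf.
have [rf jf [M fM]] := bf.
have bfg : bounded_measurable (fun W => f (unitary_mul g W)).
  split; [exact: measurableT_comp rf mg|exact: measurableT_comp jf mg|].
  by exists M.
by congr (_ +i* _)%C; apply: inv => //;
  [exact: Re_integrable bfg|exact: Im_integrable bfg].
Qed.

End Haar.

(** * Fourth moments of a Haar unitary *)

Definition mixl (I : Type) (K K' : I * I) : I * I := (K'.1, K.2).

(** [mixl] and [mixr] exchange the first components of [K] and [K']; they return the two halves of
    the result. *)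
Definition mixr (I : Type) (K K' : I * I) : I * I := (K.1, K'.2).

Section Moments.
Variables (R : realType) (d : nat).
Local Notation C := (Cplx R).
Local Notation G := (borelU R d).
Variable mu : probability G R.

(** Each factor is expanded in turn while the other three are kept as one bounded measurable factor.
    The nested form of the result is that of [twirl_invariant], so the lemma can be read from right
    to left there. *)
Lemma Cintegral_multilinear (I : finType) (c1 c2 c3 c4 : I -> C)
    (X1 X2 X3 X4 : I -> G -> C) :
  (forall k, bounded_measurable (X1 k)) -> (forall k, bounded_measurable (X2 k)) ->
  (forall k, bounded_measurable (X3 k)) -> (forall k, bounded_measurable (X4 k)) ->
  Cintegral mu (fun W => (\sum_k c1 k * X1 k W) * (\sum_k c2 k * X2 k W) *
      (\sum_k c3 k * X3 k W)^* * (\sum_k c4 k * X4 k W)^*) =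
  \sum_k1 c1 k1 * \sum_k2 c2 k2 * \sum_k3 (c3 k3)^* * \sum_k4 (c4 k4)^* *
    Cintegral mu (fun W => X1 k1 W * X2 k2 W * (X3 k3 W)^* * (X4 k4 W)^*).
Proof.
move=> b1 b2 b3 b4.
have bc k3 := bounded_measurable_conj (b3 k3).
have bd k4 := bounded_measurable_conj (b4 k4).
have lin (c : I -> C) (X : I -> G -> C) (Y : G -> C) (F : G -> C) :
    (forall k, bounded_measurable (X k)) -> bounded_measurable Y ->
    (forall W, F W = (\sum_k c k * X k W) * Y W) ->
    Cintegral mu F = \sum_k c k * Cintegral mu (fun W => X k W * Y W).
  move=> bX bY FE.
  have -> : F = (fun W => \sum_k c k * (X k W * Y W)).
    by apply/funext => W; rewrite FE mulr_suml; under eq_bigr do rewrite -mulrA.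
  have bXY k : bounded_measurable (fun W => X k W * Y W).
    exact: bounded_measurableM.
  rewrite Cintegral_sum => [|k]; first by under eq_bigr do rewrite CintegralZ //.
  by apply: bounded_measurableM => //; exact: bounded_measurable_cst.
have bs (c : I -> C) (X : I -> G -> C) : (forall k, bounded_measurable (X k)) ->
    bounded_measurable (fun W => \sum_k c k * X k W).
  move=> bX; apply: bounded_measurable_sum => k.
  by apply: bounded_measurableM => //; exact: bounded_measurable_cst.
have cs (c : I -> C) (X : I -> G -> C) W :
    (\sum_k c k * X k W)^* = \sum_k (c k)^* * (X k W)^*.
  by rewrite rmorph_sum; under eq_bigr do rewrite rmorphM.
rewrite (lin c1 X1 (fun W => (\sum_k c2 k * X2 k W) *
      (\sum_k c3 k * X3 k W)^* * (\sum_k c4 k * X4 k W)^*)) => //; first last.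
- by move=> W; rewrite !mulrA.
- apply: bounded_measurableM (bounded_measurable_conj (bs _ _ b4)).
  exact: bounded_measurableM (bs _ _ b2) (bounded_measurable_conj (bs _ _ b3)).
apply: eq_bigr => k1 _; congr (_ * _).
rewrite (lin c2 X2 (fun W => X1 k1 W *
      (\sum_k c3 k * X3 k W)^* * (\sum_k c4 k * X4 k W)^*)) => //; first last.
- by move=> W; ring.
- apply: bounded_measurableM (bounded_measurable_conj (bs _ _ b4)).
  exact: bounded_measurableM (b1 k1) (bounded_measurable_conj (bs _ _ b3)).
apply: eq_bigr => k2 _; congr (_ * _).
rewrite (lin (fun k => (c3 k)^*) (fun k W => (X3 k W)^*) (fun W => X1 k1 W *
      X2 k2 W * (\sum_k c4 k * X4 k W)^*)) => //; first last.
- by move=> W; rewrite -cs; ring.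
- apply: bounded_measurableM (bounded_measurable_conj (bs _ _ b4)).
  exact: bounded_measurableM.
apply: eq_bigr => k3 _; congr (_ * _).
rewrite (lin (fun k => (c4 k)^*) (fun k W => (X4 k W)^*) (fun W => X1 k1 W *
      X2 k2 W * (X3 k3 W)^*)) => //; first last.
- by move=> W; rewrite -cs; ring.
- exact: bounded_measurableM (bounded_measurableM (b1 k1) (b2 k2)) (bc k3).
apply: eq_bigr => k4 _; congr (_ * _).
by congr (Cintegral mu _); apply/funext => W; ring.
Qed.

Hypothesis d_ge2 : (2 <= d)%N.
Hypothesis mu_haar : is_haar mu.
Variable V0 : 'M[C]_d.
Hypothesis V0_unitary : V0 \is unitarymx.

Local Notation P W := (unitary_mx W *m V0).

Lemma bounded_measurable_mulmx_entry i j :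
  bounded_measurable (fun W : G => P W i j).
Proof.
under eq_fun do rewrite mxE.
apply: bounded_measurable_sum => k; apply: bounded_measurableM.
  exact: bounded_measurable_entry.
exact: bounded_measurable_cst.
Qed.

Definition haar_moment a b c b2 e b3 f b4 : C :=
  Cintegral mu (fun W => P W a b * P W c b2 * (P W e b3)^* * (P W f b4)^*).

(** [V0] multiplies on the right, so a left translation of [W] acts on the row indices of [P W]
    alone and the four column indices are mere parameters. *)
Lemma haar_moment_twirl b b2 b3 b4 :
  twirl_invariant (fun a c e f => haar_moment a b c b2 e b3 f b4).
Proof.
move=> g /unitary_mx_surj [h hE] a c e f.
have bP := bounded_measurable_mulmx_entry.
rewrite -Cintegral_multilinear // /haar_moment.
rewrite -[LHS](Cintegral_mul mu_haar h); last first.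
  exact: bounded_measurable_moment.
congr (Cintegral mu _); apply/funext => W.
have key i j : P (unitary_mul h W) i j = \sum_k g i k * P W k j.
  by rewrite unitary_mxM hE -mulmxA mxE.
by rewrite !key.
Qed.

Lemma sum_unitary_col (A : 'M[C]_d) b b' : A \is unitarymx ->
  \sum_a A a b * (A a b')^* = (b == b')%:R.
Proof.
move=> /unitarymxP /mulmx1C /matrixP /(_ b' b); rewrite !mxE eq_sym => <-.
by apply: eq_bigr => a _; rewrite !mxE mulrC.
Qed.

(** The Weingarten formula of degree two. Contracting rows in the two possible ways and using
    orthonormality of columns gives [p = d^2 x + d y] and [q = d x + d^2 y]; the system is
    invertible since [d >= 2]. *)
Lemma haar_momentE a b c b2 e b3 f b4 :
  let p := (b == b3)%:R * (b2 == b4)%:R in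
  let q := (b == b4)%:R * (b2 == b3)%:R in
  haar_moment a b c b2 e b3 f b4 = (d%:R ^+ 2 - 1)^-1 *
    ((a == e)%:R * (c == f)%:R * (p - d%:R^-1 * q) +
     (a == f)%:R * (c == e)%:R * (q - d%:R^-1 * p)).
Proof.
move=> p q; have bP := bounded_measurable_mulmx_entry.
have [x [y ME]] := twirl_invariantE (@haar_moment_twirl b b2 b3 b4) d_ge2.
have PU W : P W \is unitarymx by exact: mul_unitarymx (unitary_mxP W) V0_unitary.
have bm i j k l : bounded_measurable (fun W => P W i b * P W j b2 *
    (P W k b3)^* * (P W l b4)^*).
  exact: bounded_measurable_moment.
(* [s] and [t] choose which summed row index each conjugated entry receives, so both traces follow
   from one argument. *)
have sumM (s t : 'I_d -> 'I_d -> 'I_d) r :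
    (forall W, \sum_i \sum_j P W i b * P W j b2 * (P W (s i j) b3)^* *
       (P W (t i j) b4)^* = r) ->
    \sum_i \sum_j haar_moment i b j b2 (s i j) b3 (t i j) b4 = r.
  move=> sr; rewrite -(Cintegral_cst mu r).
  have -> : (fun _ : G => r) = fun W => \sum_i \sum_j P W i b * P W j b2 *
      (P W (s i j) b3)^* * (P W (t i j) b4)^* by apply/funext => W; rewrite sr.
  rewrite Cintegral_sum => [|i]; last exact: bounded_measurable_sum.
  by apply: eq_bigr => i _; rewrite Cintegral_sum.
have tp : \sum_i \sum_j haar_moment i b j b2 i b3 j b4 = p.
  apply: (sumM (fun i _ => i) (fun _ j => j)) => W.
  rewrite /p -(sum_unitary_col b b3 (PU W)) -(sum_unitary_col b2 b4 (PU W)).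
  rewrite mulr_suml.
  by apply: eq_bigr => i _; rewrite mulr_sumr; apply: eq_bigr => j _; ring.
have tq : \sum_i \sum_j haar_moment i b j b2 j b3 i b4 = q.
  apply: (sumM (fun _ j => j) (fun i _ => i)) => W.
  rewrite /q -(sum_unitary_col b b4 (PU W)) -(sum_unitary_col b2 b3 (PU W)).
  rewrite mulr_suml.
  by apply: eq_bigr => i _; rewrite mulr_sumr; apply: eq_bigr => j _; ring.
have s1 : \sum_(i < d) \sum_(j < d) 1 = d%:R ^+ 2 :> C.
  by rewrite !sumr_const !card_ord -mulrnA -natrX -mulnn.
have s2 : \sum_(i < d) \sum_(j < d) (i == j)%:R * (j == i)%:R = d%:R :> C.
  under eq_bigr do rewrite (sum_delta (fun j => (j == _)%:R)) eqxx.
  by rewrite sumr_const card_ord.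
have ep : p = d%:R ^+ 2 * x + d%:R * y.
  rewrite -tp -s1 -s2 !mulr_suml -big_split; apply: eq_bigr => i _.
  rewrite !mulr_suml -big_split; apply: eq_bigr => j _.
  by rewrite ME !eqxx /= !mul1r.
have eq : q = d%:R * x + d%:R ^+ 2 * y.
  rewrite -tq -s1 -s2 !mulr_suml -big_split; apply: eq_bigr => i _.
  rewrite !mulr_suml -big_split; apply: eq_bigr => j _.
  by rewrite ME !eqxx /= !mul1r.
have d0 : (d%:R : C) != 0 by rewrite pnatr_eq0 -lt0n (leq_trans _ d_ge2).
have d1 : (d%:R ^+ 2 - 1 : C) != 0.
  by rewrite subr_eq0 -natrX pnatr_eq1 gtn_eqF // -[ltnLHS](exp1n 2) ltn_exp2r.
by rewrite ME ep eq; field; rewrite d0 d1.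
Qed.

(** An index pair holds the column first and the row second. When rows and columns are matched in
    the same way, whole pairs coincide; when they are matched in opposite ways, the mixed pairs
    appear with weight [- 1 / d]. *)
Lemma haar_moment_pairs (K K' L L' : 'I_d * 'I_d) :
  Cintegral mu (fun W => P W K.2 K.1 * P W K'.2 K'.1 *
    (P W L.2 L.1)^* * (P W L'.2 L'.1)^*) =
  (d%:R ^+ 2 - 1)^-1 *
    ((K == L)%:R * (K' == L')%:R + (K' == L)%:R * (K == L')%:R - d%:R^-1 *
      ((mixl K K' == L)%:R * (mixr K K' == L')%:R +
       (mixr K K' == L)%:R * (mixl K K' == L')%:R)).
Proof.
rewrite -/(haar_moment _ _ _ _ _ _ _ _) haar_momentE.
case: K K' L L' => [i k] [i' k'] [j l] [j' l']; rewrite /mixl /mixr /=.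
by rewrite !xpair_eqE -!mulnb !natrM; ring.
Qed.

End Moments.

(** * Purities as index contractions *)

Lemma sum_mxtens (V : nmodType) m n (F : 'I_(m * n) -> V) :
  \sum_K F K = \sum_(ij : 'I_m * 'I_n) F (mxtens_index ij).
Proof.
rewrite (reindex (@mxtens_index m n)) //.
by exists (@mxtens_unindex m n) => ? _; rewrite ?mxtens_indexK ?mxtens_unindexK.
Qed.

Section Purity.
Variable R : realType.
Local Notation C := (Cplx R).

(** [Tr rho^2] for a bipartite vector with amplitudes [phi p q]. The index type is left free so that
    one formula serves both [n = d] and [n = d * d]. *)
Definition purity (I : finType) (phi : I -> I -> C) : C :=
  \sum_p \sum_p' \sum_q \sum_q'
    phi p q * phi p' q' * (phi p' q)^* * (phi p q')^*.

Lemma S_LE n (psi : 'cV[C]_(n * n)) :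
  S_L psi = n%:R / (n%:R - 1) *
    (1 - complex.Re (purity (fun p q : 'I_n => psi (mxtens_index (p, q)) 0))).
Proof.
rewrite /S_L /purity /mxtrace; congr (_ * (1 - complex.Re _)).
apply: eq_bigr => p _; rewrite mxE; apply: eq_bigr => p' _.
rewrite !mxE mulr_suml; apply: eq_bigr => q _.
rewrite mulr_sumr; apply: eq_bigr => q' _.
by rewrite !mxE !big_ord1 !mxE; ring.
Qed.

Lemma purityZ (I : finType) (phi : I -> I -> C) (r : C) :
  purity (fun p q => r * phi p q) = (r * r^*) ^+ 2 * purity phi.
Proof.
rewrite /purity mulr_sumr; apply: eq_bigr => p _.
rewrite mulr_sumr; apply: eq_bigr => p' _.
rewrite mulr_sumr; apply: eq_bigr => q _.
rewrite mulr_sumr; apply: eq_bigr => q' _.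
by rewrite !rmorphM; ring.
Qed.

Variable d : nat.
Implicit Types (X : 'M[C]_(d * d)) (K : 'I_d * 'I_d).

Definition op_entry X (p q : 'I_d) K : C :=
  X (mxtens_index (p, q)) (mxtens_index K).

Lemma ket2E (i j k l : 'I_d) :
  (ket2 i j : 'cV[C]_(d * d)) (mxtens_index (k, l)) 0 = (i == k)%:R * (j == l)%:R.
Proof.
(* tensmxE needs 1 * 1 columns with column index mxtens_index (0, 0). *)
transitivity ((ket i *t ket j : 'M[C]_(d * d, 1 * 1)) (mxtens_index (k, l))
    (mxtens_index (0, 0))).
  by congr (fun_of_matrix _ _ _); apply: val_inj.
by rewrite tensmxE !mxE !andbT ![_ == k]eq_sym ![_ == l]eq_sym.
Qed.

Lemma psi_plusE (i j : 'I_d) :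
  psi_plus d (mxtens_index (i, j)) 0 = ((Num.sqrt d%:R)^-1)%:C%C * (i == j)%:R :> C.
Proof.
rewrite mxE summxE; congr (_ * _).
under eq_bigr do rewrite ket2E eq_sym.
exact: (sum_delta (fun k => (k == j)%:R)).
Qed.

Lemma mxtens_index_eq m n (a b : 'I_m * 'I_n) :
  (mxtens_index a == mxtens_index b) = (a == b).
Proof. exact: (can_eq (@mxtens_indexK m n)). Qed.

Lemma swapmx_entry p q i k :
  swapmx d (mxtens_index (p, q)) (mxtens_index (i, k)) = ((k, i) == (p, q))%:R :> C.
Proof.
rewrite summxE.
under eq_bigr => a _.
  rewrite summxE.
  under eq_bigr => b _.
    rewrite mxE big_ord1 /adjmx [X in _ * X]mxE [X in X^*]mxE !ket2E.
    rewrite rmorphM /= !conjC_nat.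
    rewrite [_ * (_ * _)](_ : _ = (i == b)%:R *
      ((b == q)%:R * ((k == a)%:R * (a == p)%:R))); last first.
      by rewrite [b == i]eq_sym [a == k]eq_sym; ring.
    over.
  rewrite sum_delta.
  rewrite [_ * _](_ : _ = (k == a)%:R * ((a == p)%:R * (i == q)%:R)); last by ring.
  over.
by rewrite sum_delta xpair_eqE -mulnb natrM.
Qed.

Lemma mulmx_swapmxE X r i k :
  (X *m swapmx d) r (mxtens_index (i, k)) = X r (mxtens_index (k, i)).
Proof.
rewrite mxE sum_mxtens.
under eq_bigr => K _ do
  rewrite {2}(surjective_pairing K) swapmx_entry -surjective_pairing mulrC.
exact: (sum_delta (fun K => X r (mxtens_index K))).
Qed.

Lemma Psi_plus_1324E (K L : 'I_(d * d)) :
  Psi_plus_1324 d (mxtens_index (K, L)) 0 = d%:R^-1 * (K == L)%:R :> C.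
Proof.
case: (mxtens_indexP K) => a b; case: (mxtens_indexP L) => p q.
rewrite mxE; congr (_ * _); rewrite summxE.
have E (i j : 'I_d) : (ket2 i j *t ket2 i j : 'cV[C]_((d * d) * (d * d)))
    (mxtens_index (mxtens_index (a, b), mxtens_index (p, q))) 0 =
    (i == a)%:R * (j == b)%:R * ((i == p)%:R * (j == q)%:R).
  transitivity ((ket2 i j *t ket2 i j : 'M[C]_(d * d * (d * d), 1 * 1))
    (mxtens_index (mxtens_index (a, b), mxtens_index (p, q)))
    (mxtens_index (0, 0))).
    by congr (fun_of_matrix _ _ _); apply: val_inj.
  by rewrite tensmxE !ket2E.
under eq_bigr => i _.
  rewrite summxE.
  under eq_bigr => j _.
    rewrite E [_ * _](_ : _ = (b == j)%:R *
      ((j == q)%:R * ((a == i)%:R * (i == p)%:R))); last first.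
      by rewrite [b == j]eq_sym [a == i]eq_sym; ring.
    over.
  rewrite sum_delta.
  rewrite [_ * _](_ : _ = (a == i)%:R * ((i == p)%:R * (b == q)%:R)); last by ring.
  over.
by rewrite sum_delta mxtens_index_eq xpair_eqE -mulnb natrM.
Qed.

(** The maximally entangled vector converts input indices into tensor factors. Up to [1 / d], the
    amplitudes across 12|34 form the realigned matrix of [X], with row [(p, i)] and column
    [(q, k)]. *)
Lemma opvecE X i k p q :
  opvec X (mxtens_index (mxtens_index (p, i), mxtens_index (q, k))) 0 =
  d%:R^-1 * op_entry X p q (i, k).
Proof.
rewrite mxE !mxtens_indexK mxE sum_mxtens.
transitivity (\sum_(K : 'I_(d * d) * 'I_(d * d)) X (mxtens_index (p, q)) K.1 *
    (mxtens_index (i, k) == K.2)%:R * (d%:R^-1 * (K.1 == K.2)%:R)).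
  by apply: eq_bigr => -[K L] _; rewrite tensmxE Psi_plus_1324E mxE.
rewrite -(pair_bigA _ (fun K1 K2 : 'I_(d * d) => X (mxtens_index (p, q)) K1 *
  (mxtens_index (i, k) == K2)%:R * (d%:R^-1 * (K1 == K2)%:R))) /=.
under eq_bigr => K1 _.
  under eq_bigr => K2 _ do rewrite mulrAC mulrC.
  rewrite sum_delta eq_sym.
  rewrite mulrA [_ * (_ == _)%:R]mulrC.
  over.
exact: etrans (sum_delta (fun M => X _ M / d%:R) _) (mulrC _ _).
Qed.

(** The output indices are contracted as in [purity]; [s] and [t] select the input pairs of the two
    conjugated factors. All four terms of the moment formula are instances. *)
Definition tensor_contraction (s t : 'I_d * 'I_d -> 'I_d * 'I_d -> 'I_d * 'I_d)
    (e : 'I_d -> 'I_d -> 'I_d * 'I_d -> C) : C :=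
  \sum_p \sum_p' \sum_q \sum_q' \sum_K \sum_K'
    e p q K * e p' q' K' * (e p' q (s K K'))^* * (e p q' (t K K'))^*.

Lemma sum_regroup
    (F : 'I_d -> 'I_d -> 'I_d -> 'I_d -> 'I_d * 'I_d -> 'I_d * 'I_d -> C) :
  \sum_(A : 'I_d * 'I_d) \sum_(A' : 'I_d * 'I_d)
  \sum_(B : 'I_d * 'I_d) \sum_(B' : 'I_d * 'I_d)
    F A.1 A'.1 B.1 B'.1 (A.2, B.2) (A'.2, B'.2) =
  \sum_p \sum_p' \sum_q \sum_q' \sum_K \sum_K' F p p' q q' K K'.
Proof.
under eq_bigr do rewrite pair_bigA pair_bigA.
rewrite pair_bigA.
under [RHS]eq_bigr do rewrite pair_bigA pair_bigA pair_bigA pair_bigA.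
rewrite [RHS]pair_bigA /=.
(* The left index is [(A, ((A', B), B'))], the right one [(p, ((((p', q), q'), K), K'))]. With
   [A = (p, i)] and [B = (q, k)], and likewise for the primed ones, [h] regroups the inputs as
   [K = (i, k)] and [K' = (i', k')]. *)
pose h (x : ('I_d * 'I_d) * ((('I_d * 'I_d) * ('I_d * 'I_d)) * ('I_d * 'I_d))) :=
  (x.1.1, ((((x.2.1.1.1, x.2.1.2.1), x.2.2.1), (x.1.2, x.2.1.2.2)),
            (x.2.1.1.2, x.2.2.2))).
rewrite [RHS](reindex h) //=.
exists (fun y => ((y.1, y.2.1.2.1),
  (((y.2.1.1.1.1, y.2.2.1), (y.2.1.1.1.2, y.2.1.2.2)), (y.2.1.1.2, y.2.2.2)))).
  by move=> [[? ?] [[[? ?] [? ?]] [? ?]]].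
by move=> [? [[[[? ?] ?] [? ?]] [? ?]]].
Qed.

(** The conjugated amplitudes sit at [(A', B)] and [(A, B')], so their inputs are [(i', k)] and
    [(i, k')], which are [mixl K K'] and [mixr K K']. Each of the four amplitudes contributes
    [1 / d]. *)
Lemma purity_opvec X :
  purity (fun A B => opvec X (mxtens_index (A, B)) 0) =
  (d%:R ^+ 4)^-1 * tensor_contraction (@mixl _) (@mixr _) (op_entry X).
Proof.
rewrite /tensor_contraction -sum_regroup /purity /mixl /mixr.
rewrite sum_mxtens mulr_sumr; apply: eq_bigr => -[p i] _ /=.
rewrite sum_mxtens mulr_sumr; apply: eq_bigr => -[p' i'] _ /=.
rewrite sum_mxtens mulr_sumr; apply: eq_bigr => -[q k] _ /=.
rewrite sum_mxtens mulr_sumr; apply: eq_bigr => -[q' k'] _ /=.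
by rewrite !opvecE !rmorphM !fmorphV /= conjC_nat -exprVn; ring.
Qed.

(** Multiplying by the swap on the right exchanges the components of every input pair. Undoing this
    by reindexing [K] and [K'] interchanges [mixl] and [mixr]. *)
Lemma tensor_contraction_swap X :
  tensor_contraction (@mixl _) (@mixr _) (op_entry (X *m swapmx d)) =
  tensor_contraction (@mixr _) (@mixl _) (op_entry X).
Proof.
rewrite /tensor_contraction; apply: eq_bigr => p _; apply: eq_bigr => p' _.
apply: eq_bigr => q _; apply: eq_bigr => q' _.
have bs : bijective (fun K => (K.2, K.1)).
  by exists (fun K => (K.2, K.1)) => -[].
rewrite [RHS](reindex (fun K => (K.2, K.1))) /=; last exact: onW_bij.
apply: eq_bigr => -[i k] _.
rewrite [RHS](reindex (fun K => (K.2, K.1))) /=; last exact: onW_bij.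
apply: eq_bigr => -[i' k'] _.
by rewrite /mixl /mixr /op_entry !mulmx_swapmxE.
Qed.

(** Across 12|34 the amplitudes of the swap are [1 / d] times a permutation matrix of size [d^2]:
    the vector is maximally entangled. *)
Lemma purity_opvec_swap : (0 < d)%N ->
  purity (fun A B => opvec (swapmx d) (mxtens_index (A, B)) 0) =
  (d%:R ^+ 2)^-1 :> C.
Proof.
move=> d_gt0.
pose sw K := (K.2, K.1).
have swK : involutive sw by case.
have E K L : opvec (swapmx d) (mxtens_index (mxtens_index K, mxtens_index L)) 0 =
    d%:R^-1 * (sw K == L)%:R :> C.
  case: K L => [p i] [q k]; rewrite opvecE /op_entry swapmx_entry.
  congr (_ * _%:R); by rewrite /sw !xpair_eqE andbC [k == p]eq_sym.
have -> : (d%:R ^+ 2)^-1 = (d%:R^-1 ^+ 4) * \sum_(K : 'I_d * 'I_d) 1 :> C.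
  rewrite sumr_const card_prod card_ord natrM; field.
  by rewrite pnatr_eq0 -lt0n.
rewrite /purity sum_mxtens mulr_sumr; apply: eq_bigr => A _.
rewrite sum_mxtens.
transitivity (d%:R^-1 ^+ 4 * \sum_A' (A == A')%:R * ((sw A' == sw A)%:R : C)).
  rewrite mulr_sumr; apply: eq_bigr => A' _.
  rewrite sum_mxtens.
  transitivity (d%:R^-1 ^+ 4 *
    \sum_B (sw A == B)%:R * ((sw A' == B)%:R * (A == A')%:R : C)).
    rewrite mulr_sumr; apply: eq_bigr => B _.
    rewrite sum_mxtens.
    transitivity (d%:R^-1 ^+ 4 * \sum_B' (sw A' == B')%:R *
      ((sw A == B)%:R * ((sw A' == B)%:R * (sw A == B')%:R) : C)).
      rewrite mulr_sumr; apply: eq_bigr => B' _.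
      by rewrite !E !rmorphM !fmorphV /= !conjC_nat; ring.
    by rewrite sum_delta (inj_eq (can_inj swK)).
  by rewrite sum_delta [(sw A' == _)%:R * _]mulrC.
by rewrite sum_delta eqxx.
Qed.

Lemma unitary_row_dot (U : 'M[C]_(d * d)) p q p' q' : U \is unitarymx ->
  \sum_K op_entry U p q K * (op_entry U p' q' K)^* = (p == p')%:R * (q == q')%:R.
Proof.
move=> /unitarymxP /matrixP /(_ (mxtens_index (p, q)) (mxtens_index (p', q'))).
rewrite !mxE mxtens_index_eq xpair_eqE -mulnb natrM => <-.
by rewrite sum_mxtens; apply: eq_bigr => K _; rewrite !mxE.
Qed.

(** The sums over [K] and [K'] are two inner products of rows of [U]. They force [p = p'] and leave
    [q] and [q'] free, whence [d * d^2]. The other pairing of whole pairs forces [q = q']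
    instead. *)
Lemma tensor_contraction_unitary1 (U : 'M[C]_(d * d)) : U \is unitarymx ->
  tensor_contraction (fun K _ => K) (fun _ K' => K') (op_entry U) = d%:R ^+ 3.
Proof.
move=> Uu; rewrite /tensor_contraction.
transitivity (\sum_(p < d) \sum_(p' < d)
    (p == p')%:R * ((p' == p)%:R * d%:R ^+ 2) : C).
  apply: eq_bigr => p _; apply: eq_bigr => p' _.
  transitivity (\sum_(q < d) \sum_(q' < d)
      (p == p')%:R * (p' == p)%:R : C); last first.
    by rewrite !sumr_const !card_ord -mulrnA -[LHS]mulr_natr natrM; ring.
  apply: eq_bigr => q _; apply: eq_bigr => q' _.
  transitivity ((\sum_K op_entry U p q K * (op_entry U p' q K)^*) *
      \sum_K op_entry U p' q' K * (op_entry U p q' K)^*).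
    rewrite mulr_suml; apply: eq_bigr => K _.
    by rewrite mulr_sumr; apply: eq_bigr => K' _; ring.
  by rewrite !unitary_row_dot // !eqxx !mulr1.
under eq_bigr => p _ do rewrite sum_delta eqxx mul1r.
by rewrite sumr_const card_ord -[LHS]mulr_natr; ring.
Qed.

Lemma tensor_contraction_unitary2 (U : 'M[C]_(d * d)) : U \is unitarymx ->
  tensor_contraction (fun _ K' => K') (fun K _ => K) (op_entry U) = d%:R ^+ 3.
Proof.
move=> Uu; rewrite /tensor_contraction.
transitivity (\sum_(p < d) \sum_(p' < d) \sum_(q < d) \sum_(q' < d)
    (q == q')%:R * (q' == q)%:R : C).
  apply: eq_bigr => p _; apply: eq_bigr => p' _.
  apply: eq_bigr => q _; apply: eq_bigr => q' _.
  transitivity ((\sum_K op_entry U p q K * (op_entry U p q' K)^*) *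
      \sum_K op_entry U p' q' K * (op_entry U p' q K)^*).
    rewrite mulr_suml; apply: eq_bigr => K _.
    by rewrite mulr_sumr; apply: eq_bigr => K' _; ring.
  by rewrite !unitary_row_dot // !eqxx !mul1r.
under eq_bigr => p _ do under eq_bigr => p' _ do under eq_bigr => q _ do
  rewrite sum_delta eqxx.
by rewrite !sumr_const !card_ord -!mulrnA -[LHS]mulr_natr !natrM /=; ring.
Qed.

Lemma sum_delta2 (I : finType) (F G : I -> C) (A B : I) :
  \sum_L F L * \sum_L' G L' * ((A == L)%:R * (B == L')%:R) = F A * G B.
Proof.
rewrite -(sum_delta (fun L => F L * G B)); apply: eq_bigr => L _.
rewrite [RHS]mulrCA; congr (_ * _); rewrite -(sum_delta G B).
by rewrite mulr_sumr; apply: eq_bigr => L' _; ring.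
Qed.

End Purity.

(** * Averaged purity of the output state *)

Section Average.
Variables (R : realType) (d : nat).
Local Notation C := (Cplx R).
Local Notation G := (borelU R d).
Variable mu : probability G R.
Hypothesis d_ge2 : (2 <= d)%N.
Hypothesis mu_haar : is_haar mu.
Variable V0 : 'M[C]_d.
Hypothesis V0_unitary : V0 \is unitarymx.
Local Notation P W := (unitary_mx W *m V0).

Lemma bounded_measurable_contribution (e : 'I_d -> 'I_d -> 'I_d * 'I_d -> C) p p' q q' :
  bounded_measurable (fun W : G =>
    (\sum_K e p q K * P W K.2 K.1) * (\sum_K e p' q' K * P W K.2 K.1) *
    (\sum_K e p' q K * P W K.2 K.1)^* * (\sum_K e p q' K * P W K.2 K.1)^*).
Proof.
have bP := bounded_measurable_mulmx_entry V0.
have bs i j : bounded_measurable (fun W : G => \sum_K e i j K * P W K.2 K.1).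
  apply: bounded_measurable_sum => K.
  by apply: bounded_measurableM; [exact: bounded_measurable_cst|exact: bP].
exact: bounded_measurable_moment.
Qed.

Lemma bounded_measurable_purity (e : 'I_d -> 'I_d -> 'I_d * 'I_d -> C) :
  bounded_measurable (fun W : G => purity (fun p q => \sum_K e p q K * P W K.2 K.1)).
Proof.
do 4 (apply: bounded_measurable_sum => ?).
exact: bounded_measurable_contribution.
Qed.

(** The amplitudes are linear in the entries of [P W], so the purity is quartic in them. Each term
    of the moment formula ties the conjugated indices [L] and [L'] to pairs built from [K] and [K'],
    leaving a [tensor_contraction]. *)
Lemma Cintegral_purity (e : 'I_d -> 'I_d -> 'I_d * 'I_d -> C) :
  Cintegral mu (fun W => purity (fun p q => \sum_K e p q K * P W K.2 K.1)) =
  (d%:R ^+ 2 - 1)^-1 *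
    (tensor_contraction (fun K _ => K) (fun _ K' => K') e +
     tensor_contraction (fun _ K' => K') (fun K _ => K) e - d%:R^-1 *
      (tensor_contraction (@mixl _) (@mixr _) e +
       tensor_contraction (@mixr _) (@mixl _) e)).
Proof.
have bP := bounded_measurable_mulmx_entry V0.
have bm := bounded_measurable_contribution e.
set k := (_ - 1)^-1; set r := d%:R^-1.
(* Moves the common linear combination of four terms through one level of summation. *)
have sum4 (I : finType) (F1 F2 F3 F4 : I -> C) :
    k * (\sum_i F1 i + \sum_i F2 i - r * (\sum_i F3 i + \sum_i F4 i)) =
    \sum_i k * (F1 i + F2 i - r * (F3 i + F4 i)).
  by rewrite -!big_split !mulr_sumr -sumrB mulr_sumr.
set T := fun s t p p' q q' K K' =>
  e p q K * e p' q' K' * (e p' q (s K K'))^* * (e p q' (t K K'))^*.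
transitivity (\sum_p \sum_p' \sum_q \sum_q' \sum_K \sum_K' k *
    (T (fun K _ => K) (fun _ K' => K') p p' q q' K K' +
     T (fun _ K' => K') (fun K _ => K) p p' q q' K K' - r *
      (T (@mixl _) (@mixr _) p p' q q' K K' +
       T (@mixr _) (@mixl _) p p' q q' K K'))); last first.
  rewrite /tensor_contraction.
  by do 6 (rewrite sum4; apply: eq_bigr => ? _).
rewrite /purity Cintegral_sum => [|p]; last first.
  by do 3 (apply: bounded_measurable_sum => ?).
apply: eq_bigr => p _.
rewrite Cintegral_sum => [|p']; last first.
  by do 2 (apply: bounded_measurable_sum => ?).
apply: eq_bigr => p' _.
rewrite Cintegral_sum => [|q]; last exact: bounded_measurable_sum.
apply: eq_bigr => q _; rewrite Cintegral_sum //; apply: eq_bigr => q' _.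
rewrite (@Cintegral_multilinear _ _ mu _ (e p q) (e p' q') (e p' q) (e p q')
  (fun K W => P W K.2 K.1) (fun K W => P W K.2 K.1) (fun K W => P W K.2 K.1)
  (fun K W => P W K.2 K.1)) //.
apply: eq_bigr => K _; rewrite mulr_sumr; apply: eq_bigr => K' _.
under eq_bigr => L _ do under eq_bigr => L' _ do rewrite haar_moment_pairs //.
pose c3 L := (e p' q L)^*; pose c4 L := (e p q' L)^*.
transitivity (e p q K * (e p' q' K' * (k * (
  \sum_L c3 L * \sum_L' c4 L' * ((K == L)%:R * (K' == L')%:R) +
  \sum_L c3 L * \sum_L' c4 L' * ((K' == L)%:R * (K == L')%:R) - r * (
  \sum_L c3 L * \sum_L' c4 L' * ((mixl K K' == L)%:R * (mixr K K' == L')%:R) +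
  \sum_L c3 L * \sum_L' c4 L' * ((mixr K K' == L)%:R * (mixl K K' == L')%:R)))))).
  congr (_ * (_ * _)).
  rewrite sum4; apply: eq_bigr => L _.
  rewrite -!mulrDr [r * _]mulrCA -mulrBr mulrCA; congr (_ * _).
  by rewrite sum4; apply: eq_bigr => L' _; rewrite /c4 /k /r; ring.
by rewrite !sum_delta2 /T /c3 /c4; ring.
Qed.

End Average.

(** A matrix acting on one half of the maximally entangled vector can be moved to the other half as
    its transpose. Moving [V] rather than [W] keeps the integrated [W] leftmost, where left
    invariance applies, and makes [K.2] the row index. *)
Lemma tensor_psi_plusE (R : realType) d (U : 'M[Cplx R]_(d * d))
    (V W : 'M[Cplx R]_d) p q :
  (U *m (V *t W) *m psi_plus d) (mxtens_index (p, q)) 0 =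
  ((Num.sqrt d%:R)^-1)%:C%C * \sum_K op_entry U p q K * (W *m V^T) K.2 K.1.
Proof.
rewrite -mulmxA mxE sum_mxtens mulr_sumr; apply: eq_bigr => -[i k] _.
rewrite [LHS]mulrC [RHS]mulrCA [RHS]mulrC; congr (_ * _).
rewrite /= mxE sum_mxtens mxE mulr_sumr.
transitivity (\sum_j \sum_l (V *t W) (mxtens_index (i, k)) (mxtens_index (j, l)) *
  psi_plus d (mxtens_index (j, l)) 0).
  by rewrite pair_bigA; apply: eq_bigr => -[].
rewrite exchange_big /=.
apply: eq_bigr => l _; under eq_bigr => j _.
  rewrite psi_plusE tensmxE [_ * _](_ : _ = (l == j)%:R *
    (((Num.sqrt d%:R)^-1)%:C%C * (W k l * V i j))); last by rewrite eq_sym; ring.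
  over.
by rewrite (sum_delta (fun j => _ * (_ * V i j))) mxE.
Qed.

(** * From averaged purities to the disentangling power *)

Lemma Re_realM (R : realType) (r : R) (z : Cplx R) :
  complex.Re (r%:C%C * z) = r * complex.Re z.
Proof. by rewrite complex_ReM /= mul0r subr0. Qed.

Lemma complex_ReD (R : realType) (x y : Cplx R) :
  complex.Re (x + y) = complex.Re x + complex.Re y.
Proof. by case: x; case: y. Qed.

Lemma Re_real (R : realType) (r : R) : complex.Re (r%:C%C : Cplx R) = r.
Proof. by []. Qed.

Lemma S_L_opvec_swap (R : realType) (d : nat) : (2 <= d)%N ->
  S_L (opvec (swapmx d)) = 1 :> R.
Proof.
move=> d_ge2.
have d0 : (d%:R : R) != 0 by rewrite pnatr_eq0 -lt0n ltnW.
have d2 : (d%:R * d%:R - 1 : R) != 0.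
  by rewrite subr_eq0 -natrM pnatr_eq1 gtn_eqF // -[ltnLHS](exp1n 2) mulnn ltn_exp2r.
rewrite S_LE purity_opvec_swap; last exact: ltnW.
have -> : (d%:R ^+ 2)^-1 = ((d%:R ^+ 2)^-1)%:C%C :> Cplx R.
  by rewrite fmorphV rmorphXn rmorph_nat.
by rewrite Re_real natrM; field; rewrite d0 d2.
Qed.

Lemma mean_entropy (R : realType) (d : nat) (mu : probability (borelU R d) R)
    (U : 'M[Cplx R]_(d * d)) (V : unitaryGroup R d) (a b : Cplx R) :
  (2 <= d)%N -> is_haar mu -> U \is unitarymx ->
  tensor_contraction (@mixl _) (@mixr _) (op_entry U) = d%:R ^+ 4 * a ->
  tensor_contraction (@mixr _) (@mixl _) (op_entry U) = d%:R ^+ 4 * b ->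
  \int[mu]_(W in setT) S_L (U *m (unitary_mx V *t unitary_mx W) *m psi_plus d) =
  d%:R / (d%:R - 1) * (1 - d%:R / (d%:R ^+ 2 - 1) *
    (2 - (complex.Re a + complex.Re b))).
Proof.
move=> d_ge2 mu_haar U_unitary ca cb.
have dR0 : (d%:R : R) != 0 by rewrite pnatr_eq0 -lt0n ltnW.
have dC0 : (d%:R : Cplx R) != 0 by rewrite pnatr_eq0 -lt0n ltnW.
have dC1 : (d%:R ^+ 2 - 1 : Cplx R) != 0.
  by rewrite subr_eq0 -natrX pnatr_eq1 gtn_eqF // -[ltnLHS](exp1n 2) ltn_exp2r.
have dR1 : (d%:R ^+ 2 - 1 : R) != 0.
  by rewrite subr_eq0 -natrX pnatr_eq1 gtn_eqF // -[ltnLHS](exp1n 2) ltn_exp2r.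
set k : R := d%:R / (d%:R - 1).
have VTu : (unitary_mx V)^T \is unitarymx by rewrite trmx_unitary unitary_mxP.
pose f W := purity (fun p q =>
  \sum_K op_entry U p q K * (unitary_mx W *m (unitary_mx V)^T) K.2 K.1).
have bf : bounded_measurable (f : borelU R d -> Cplx R).
  exact: bounded_measurable_purity.
(* The entropy is an affine function of the purity with real coefficients, so its integral is the
   real part of a complex one. The factor [1 / d^2] comes from the normalization [1 / sqrt d] in
   each of four amplitudes. *)
transitivity (complex.Re (Cintegral mu (fun W =>
    k%:C%C + (- (k * d%:R^-1 ^+ 2))%:C%C * f W))).
  apply: eq_Rintegral => W _; rewrite S_LE.
  under [X in purity X]eq_fun => p do under eq_fun => q do
    rewrite tensor_psi_plusE.
  rewrite purityZ -/(f W).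
  have -> : ((Num.sqrt d%:R)^-1)%:C%C * (((Num.sqrt d%:R)^-1)%:C%C)^* =
      (d%:R^-1)%:C%C :> Cplx R.
    rewrite [X in _ * X](_ : _ = ((Num.sqrt d%:R)^-1)%:C%C).
      by rewrite -rmorphM /= -invfM -expr2 sqr_sqrtr // ler0n.
    exact: conjc_real.
  by rewrite -rmorphXn raddfD /= !Re_realM -/k; ring.
rewrite CintegralD; last 2 first.
- exact: bounded_measurable_cst.
- by apply: bounded_measurableM => //; exact: bounded_measurable_cst.
rewrite Cintegral_cst CintegralZ // Cintegral_purity //.
rewrite tensor_contraction_unitary1 // tensor_contraction_unitary2 // ca cb.
rewrite raddfD /= Re_realM.
(* Real coefficients are displayed as embedded reals so that [Re] passes through to [a] and [b]. *)
rewrite [X in complex.Re X](_ : _ =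
    ((d%:R ^+ 2 - 1)^-1 * d%:R ^+ 3 *+ 2)%:C%C +
    (- ((d%:R ^+ 2 - 1)^-1 * d%:R ^+ 3))%:C%C * (a + b)); last first.
  rewrite rmorphMn rmorphN !rmorphM fmorphV rmorphB !rmorphXn rmorph1 rmorph_nat.
  by field; rewrite dC0 dC1.
rewrite complex_ReD Re_realM complex_ReD Re_real.
move: k (complex.Re a) (complex.Re b) => k x y.
by field; rewrite dR0 dR1.
Qed.

Theorem theorem2 (R : realType) (d : nat) (d_ge2 : (2 <= d)%N)
    (mu : probability (borelU R d) R) (mu_haar : is_haar mu)
    (U : 'M[Cplx R]_(d * d)) (U_unitary : U \is unitarymx) :
  disentangling_power mu U =
  (d%:R - 1)^-1 * (S_L (opvec U) + S_L (opvec (U *m swapmx d))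
                   - S_L (opvec (swapmx d))).
Proof.
have d0 : (d%:R : R) != 0 by rewrite pnatr_eq0 -lt0n ltnW.
have dC0 : (d%:R : Cplx R) != 0 by rewrite pnatr_eq0 -lt0n ltnW.
have d1 : (d%:R - 1 : R) != 0 by rewrite subr_eq0 pnatr_eq1 gtn_eqF.
have d2 : (d%:R * d%:R - 1 : R) != 0.
  by rewrite subr_eq0 -natrM pnatr_eq1 gtn_eqF // -[ltnLHS](exp1n 2) mulnn ltn_exp2r.
have ca : tensor_contraction (@mixl _) (@mixr _) (op_entry U) =
    d%:R ^+ 4 * purity (fun A B => opvec U (mxtens_index (A, B)) 0).
  by rewrite purity_opvec mulrA divff ?mul1r // expf_neq0.
have cb : tensor_contraction (@mixr _) (@mixl _) (op_entry U) = d%:R ^+ 4 *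
    purity (fun A B => opvec (U *m swapmx d) (mxtens_index (A, B)) 0).
  rewrite -tensor_contraction_swap purity_opvec mulrA divff ?mul1r //.
  exact: expf_neq0.
(* The constant [1 - d / (d - 1)] equals [- 1 / (d - 1)]; the resulting [- 1] in the bracket is
   matched with the entropy of the swap. *)
have key (x y : R) : 1 - d%:R / (d%:R - 1) *
      (1 - d%:R / (d%:R ^+ 2 - 1) * (2 - (x + y))) =
    (d%:R - 1)^-1 * ((d * d)%:R / ((d * d)%:R - 1) * (1 - x) +
      (d * d)%:R / ((d * d)%:R - 1) * (1 - y) - 1).
  by rewrite natrM; field; rewrite d1 d2.
rewrite /disentangling_power.
under eq_Rintegral do
  rewrite (mean_entropy _ d_ge2 mu_haar U_unitary ca cb).
rewrite Rintegral_probability_cst key.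
congr (_ * (_ + _ - _)); apply/esym; [exact: S_LE|exact: S_LE|].
exact: S_L_opvec_swap.
Qed.
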